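(* Let $\mathbb{F}$ be a field with $\mathrm{char}(\mathbb{F})\ne 2$, let $Q_8$ be the quaternion group of order $8$ and $C_2$ the cyclic group of order $2$. Then $\beta(Q_8\times C_2)=7$.
   Context: For a finite group $G$, a $G$-module is a finite dimensional $\mathbb{F}$-vector space $V$ with a linear action of $G$. $S(V)$ is the symmetric algebra of $V$ (a polynomial algebra on a basis of $V$, with each variable of degree one), on which $G$ acts by $\mathbb{F}$-algebra automorphisms extending the action on $V$, and $S(V)^G$ is the subalgebra of $G$-invariants. $\beta(S(V)^G)$ is the minimal non-negative integer $d$ such that the $\mathbb{F}$-algebra $S(V)^G$ is generated by its homogeneous components of degree at most $d$. The Noether number is $\beta(G)=\sup\{\beta(S(V)^G): V \text{ is a } G\text{-module over }\mathbb{F}\}$. *)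

(* Defs.v *)
From HB Require Import structures.
From mathcomp Require Export all_boot all_order all_fingroup all_algebra.
From mathcomp Require Export all_solvable all_character.
From mathcomp.multinomials Require Export mpoly.

Set Implicit Arguments.
Unset Strict Implicit.
Unset Printing Implicit Defensive.

Import GRing.Theory.
Local Open Scope ring_scope.

(* The smallest F-subalgebra of A containing P. *)
Inductive generated_subalgebra (F : fieldType) (A : algType F)
    (P : A -> Prop) : A -> Prop :=
| GenSub a of P a : generated_subalgebra P a
| GenOne : generated_subalgebra P 1
| GenLin (c : F) a b of generated_subalgebra P a & generated_subalgebra P b :
    generated_subalgebra P (c *: a + b)
| GenMul a b of generated_subalgebra P a & generated_subalgebra P b :
    generated_subalgebra P (a * b).

Section Noether.

Variables (F : fieldType) (gT : finGroupType) (G : {group gT}).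

Section Module.

(* A G-module of dimension n is 'rV[F]_n with g acting as right multiplication
   by rG g.  S(V) is {mpoly F[n]}, with 'X_i standing for the i-th standard
   basis vector, so that g sends 'X_i to the i-th row of rG g. *)
Variables (n : nat) (rG : mx_representation F G n).

Definition sym_act (g : gT) (f : {mpoly F[n]}) : {mpoly F[n]} :=
  f \mPo [tuple \sum_(j < n) rG g i j *: 'X_j | i < n].

Definition sym_invariant (f : {mpoly F[n]}) : Prop :=
  forall g, g \in G -> sym_act g f = f.

Definition homog_invariant_le (d : nat) (f : {mpoly F[n]}) : Prop :=
  sym_invariant f /\ exists2 k, (k <= d)%N & f \is k.-homog.

Definition invariants_generated_upto (d : nat) : Prop :=
  forall f, sym_invariant f -> generated_subalgebra (homog_invariant_le d) f.

Definition is_beta (d : nat) : Prop :=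
  invariants_generated_upto d /\
  forall e, invariants_generated_upto e -> (d <= e)%N.

End Module.

Definition beta_bounded_by (b : nat) : Prop :=
  forall n (rG : mx_representation F G n), exists2 d, is_beta rG d & (d <= b)%N.

(* A relation rather than a function, since the supremum may be infinite. *)
Definition is_noether_number (b : nat) : Prop :=
  beta_bounded_by b /\ forall c, beta_bounded_by c -> (b <= c)%N.

End Noether.

Definition Q8xC2 : {group 'Q_8 * 'Z_2} := setX_group 'Q_8%G [set: 'Z_2]%G.

(* Main.v *)
From HB Require Import structures.
From Stdlib Require Import Classical_Prop.
Require Import Defs.
From mathcomp Require Import polyXY fieldext ring.

Set Implicit Arguments.
Unset Strict Implicit.
Unset Printing Implicit Defensive.

Import GRing.Theory.
Local Open Scope ring_scope.

(** Let z be the central involution of Q_8 and let c generate C_2.  The quotient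
    of the group by <z> is elementary abelian of order 8; its characters take the
    values 1 and -1, so, 2 being invertible, they are all defined over F and a
    space on which z acts trivially is a sum of one-dimensional eigenspaces.
    Recording a character by its values on the two generators of Q_8 and on c
    gives a weight in C_2^3.

    Upper bound.  In any module the linear forms are spanned by weight vectors
    (where z acts as 1) and by minus forms (where z acts as -1), the latter being
    chosen to be eigenvectors of c.  A product of two minus forms is fixed by z,
    so it is a sum of quadratic weight vectors.  In a product of linear forms,
    pair the minus forms having the same c-sign with each other: every pair but
    at most one then expands into quadrics that c fixes, and at most one quadric
    is negated by c (span_normal_form, normal_form_final).  If one minus form is
    left over, then z negates the product and averaging over the group kills it.
    Hence invariants are spanned by products of weight vectors of degrees 1 and 2
    whose weights sum to zero, with at most one quadric negated by c.  Such a
    product splits into zero-sum factors of degree at most 7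
    (admissible_short_zero_sum): among three quadrics fixed by c, whose weights
    lie in C_2^2, some have zero sum and these have degree at most 6; if there
    are fewer of them, there are at most three quadrics, and among any four
    factors some have zero sum and these have degree at most 3 * 2 + 1.

    Lower bound.  Over K = F[i] let W be the two-dimensional module of Q_8, with
    coordinates X, Y, let W' be W twisted by the sign character of C_2, with
    coordinates X', Y', and let t span that sign character.  Regarding W and W' as
    F-spaces gives a module of dimension 9 over F, whose polynomial invariants map
    to those of W + W' + t.  Put Y' = 0 and consider the difference of the
    coefficients of X^4 Y X' t and of Y^5 X' t.  A monomial that occurs in an
    invariant is fixed by the diagonal elements of the group, so the only
    factorizations of these two monomials that contribute to a product of
    invariants are the trivial ones, X^4 * Y X' t, Y^4 * Y X' t and
    X Y * X^3 X' t.  The second generator of Q_8 swaps X and Y up to sign, hence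
    an invariant has equal coefficients at X^4 and Y^4 and coefficient 0 at X Y.
    So the difference vanishes on products of invariants without constant term
    (functionalM), whereas it is nonzero on the average over the group of a
    monomial of degree 7 that maps to X^4 Y X' t (functional_reynolds_witness). *)

(** * Generators and normal form of the quaternion group *)

Section QuaternionGroup.
Local Open Scope group_scope.

Definition quaternion_pair (x y : 'Q_8) :=
  [/\ x ^+ 4 = 1, y ^+ 2 = x ^+ 2, y * x = x ^+ 3 * y
    & forall g, exists ab : 'I_4 * 'I_2, g = x ^+ ab.1 * y ^+ ab.2].

Lemma quaternion_word_reduce (x y : 'Q_8) (a b : nat) :
  x ^+ 4 = 1 -> y ^+ 2 = x ^+ 2 ->
  x ^+ a * y ^+ b = x ^+ ((a + 2 * b./2) %% 4)%N * y ^+ (b %% 2)%N.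
Proof.
move=> x4 y2; set k := (a + 2 * b./2)%N.
have -> : x ^+ (k %% 4)%N = x ^+ k.
  by rewrite [in RHS](divn_eq k 4) expgD mulnC expgM x4 expg1n mul1g.
rewrite /k expgD expgM -y2 -expgM -mulgA -expgD; congr (_ * _ ^+ _).
by rewrite modn2 addnC mul2n odd_double_half.
Qed.

Lemma quaternion_generators : exists x y : 'Q_8, quaternion_pair x y.
Proof.
have [[x y]] := @generators_quaternion _ 'Q_8%G 3 isT (isog_refl _).
move=> ext [oy y2 xy]; exists x, y.
have [_ _ ox _] := ext; have [_ _ _ defG _] := extremal_generators_facts (isT : prime 2) ext.
have x4 : x ^+ 4 = 1 by rewrite -(expg_order x) ox.
have xV : x^-1 = x ^+ 3.
  by apply: (mulgI x); rewrite mulgV -expgS x4.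
split=> //.
  by rewrite -xV [RHS]conjgC conjVg xy invgK.
move=> g; have : g \in <[x]> * <[y]> by rewrite defG inE.
case/mulsgP=> _ _ /cycleP[a ->] /cycleP[b ->] ->.
exists (inord ((a + 2 * b./2) %% 4), inord (b %% 2)) => /=.
by rewrite !inordK ?ltn_mod // -quaternion_word_reduce.
Qed.

(** Injectivity is surjectivity and a count: both sides have 8 elements. *)
Lemma quaternion_normal_form_inj (x y : 'Q_8) : quaternion_pair x y ->
  injective (fun ab : 'I_4 * 'I_2 => x ^+ ab.1 * y ^+ ab.2).
Proof.
case=> _ _ _ surj; set f := fun ab => _.
apply/injectiveP/card_uniqP; rewrite size_image.
rewrite (eq_card (B := [set: 'Q_8])); last first.
  move=> g; rewrite !inE; apply/imageP.
  by have [ab ->] := surj g; exists ab.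
by rewrite (@card_quaternion 3) // card_prod !card_ord.
Qed.

End QuaternionGroup.

(** * Linear spans of predicates *)

Section Span.
Variables (F : fieldType) (A : comAlgType F).

Inductive span (P : A -> Prop) : A -> Prop :=
| Span0 : span P 0
| SpanD c a b of P a & span P b : span P (c *: a + b).

Lemma span_in (P : A -> Prop) a : P a -> span P a.
Proof.
by move=> Pa; rewrite -[a]scale1r -[_ *: _]addr0; apply: SpanD => //; left.
Qed.

Lemma span_add (P : A -> Prop) a b : span P a -> span P b -> span P (a + b).
Proof.
move=> Sa Sb; elim: Sa => [|c a0 a1 Pa _ IH]; first by rewrite add0r.
by rewrite -addrA; apply: SpanD.
Qed.

Lemma span_scale (P : A -> Prop) k a : span P a -> span P (k *: a).
Proof.
elim=> [|c a0 a1 Pa _ IH]; first by rewrite scaler0; left.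
by rewrite scalerDr scalerA; apply: SpanD.
Qed.

Lemma span_trans (P Q : A -> Prop) a :
  span P a -> (forall b, P b -> span Q b) -> span Q a.
Proof.
move=> Sa PQ; elim: Sa => [|c a0 a1 Pa _ IH]; first by left.
by apply: span_add => //; apply/span_scale/PQ.
Qed.

Lemma span_mul (P Q S : A -> Prop) a b : span P a -> span Q b ->
  (forall a b, P a -> Q b -> span S (a * b)) -> span S (a * b).
Proof.
move=> Sa Sb PQ; elim: Sa => [|c a0 a1 Pa _ IH]; first by rewrite mul0r; left.
rewrite mulrDl -scalerAl; apply: span_add => //; apply: span_scale.
elim: Sb => [|d b0 b1 Qb _ IHb]; first by rewrite mulr0; left.
rewrite mulrDr -scalerAr; apply: span_add => //.
by apply/span_scale/PQ.
Qed.

End Span.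

(** * Zero-sum sequences of weights *)

(** The three bits are the signs by which the two generators of Q_8 and the
    generator of C_2 act on an eigenvector. *)
Definition weight := (bool * bool * bool)%type.
Definition addw (v w : weight) : weight :=
  (v.1.1 (+) w.1.1, v.1.2 (+) w.1.2, v.2 (+) w.2).
Definition w0 : weight := (false, false, false).

Lemma addwA : associative addw.
Proof. by move=> [[a b] c] [[a' b'] c'] [[? ?] ?]; rewrite /addw /= !addbA. Qed.
Lemma addwC : commutative addw.
Proof.
by move=> [[a b] c] [[a' b'] c']; rewrite /addw /= ![a (+) _]addbC
  ![b (+) _]addbC ![c (+) _]addbC.
Qed.
Lemma add0w : left_id w0 addw.
Proof. by move=> [[a b] c]. Qed.
HB.instance Definition _ := Monoid.isComLaw.Build weight w0 addw addwA addwC add0w.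

Section ZeroSum.
Variable A : eqType.

(** A factor of a product, with its weight and its degree. *)
Definition item := (weight * nat * A)%type.
Definition wt_sum (l : seq item) := \big[addw/w0]_(i <- l) i.1.1.
Definition deg_sum (l : seq item) := (\sum_(i <- l) i.1.2)%N.
Definition is_quadric (i : item) := i.1.2 == 2.
Definition C2_even_quadric (i : item) := (i.1.2 == 2) && ~~ i.1.1.2.
Definition C2_odd_quadric (i : item) := (i.1.2 == 2) && i.1.1.2.
(** The shape of the products that remain once the minus forms have been paired
    by C_2-sign: only the possible pair of mixed sign is negated by C_2. *)
Definition admissible (l : seq item) :=
  all (fun i => (i.1.2 == 1) || (i.1.2 == 2)) l && (count C2_odd_quadric l <= 1)%N.

Lemma perm_mask (T : eqType) (m : bitseq) (s : seq T) : size m = size s ->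
  perm_eq s (mask m s ++ mask (map negb m) s).
Proof.
elim: s m => [|a s IH] [|b m] //= [/IH perm_s].
case: b => /=; first by rewrite perm_cons.
by rewrite perm_sym perm_catC /= perm_cons perm_catC perm_sym.
Qed.

(** Quantification over the booleans in a form that evaluates, so that the two
    Davenport constants below are obtained by computation. *)
Definition bool_forall (P : bool -> bool) := P true && P false.
Lemma bool_forallP P : bool_forall P -> forall b, P b.
Proof. by case/andP=> Pt Pf []. Qed.

Definition nonempty_masks (n : nat) : seq bitseq :=
  [seq m <- iter n (fun ms => map (cons true) ms ++ map (cons false) ms) [:: [::]]
     | has id m].

Definition has_zero_sum (l : seq weight) :=
  has (fun m => foldr addw w0 (mask m l) == w0) (nonempty_masks (size l)).

Lemma has_zero_sumP (l : seq weight) : has_zero_sum l ->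
  exists m : bitseq, [/\ size m = size l, has id m &
    foldr addw w0 (mask m l) = w0].
Proof.
case/hasP=> m; rewrite mem_filter => /andP[nz_m m_in] /eqP sum0; exists m; split=> //.
elim: (size l) m {nz_m sum0} m_in => [|n IH] m /=; first by rewrite inE => /eqP->.
by rewrite mem_cat => /orP[]/mapP[m' /IH sz ->] /=; rewrite sz.
Qed.

(** The Davenport constant of C_2^2 is 3; C_2^2 is the group of the weights whose
    last bit is zero. *)
Lemma davenport_C2_2 (v1 v2 v3 : weight) : ~~ v1.2 -> ~~ v2.2 -> ~~ v3.2 ->
  has_zero_sum [:: v1; v2; v3].
Proof.
move: v1 v2 v3 => [[a1 b1] []] [[a2 b2] []] [[a3 b3] []] //= _ _ _.
have : bool_forall (fun a1 => bool_forall (fun a2 => bool_forall (fun a3 =>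
  bool_forall (fun b1 => bool_forall (fun b2 => bool_forall (fun b3 =>
  has_zero_sum [:: (a1, b1, false); (a2, b2, false); (a3, b3, false)])))))).
  by vm_compute.
move/bool_forallP/(_ a1)/bool_forallP/(_ a2)/bool_forallP/(_ a3).
by move/bool_forallP/(_ b1)/bool_forallP/(_ b2)/bool_forallP/(_ b3).
Qed.

(** The Davenport constant of C_2^3 is 4. *)
Lemma davenport_C2_3 (v1 v2 v3 v4 : weight) : has_zero_sum [:: v1; v2; v3; v4].
Proof.
move: v1 v2 v3 v4 => [[a1 b1] c1] [[a2 b2] c2] [[a3 b3] c3] [[a4 b4] c4].
have : bool_forall (fun a1 => bool_forall (fun a2 => bool_forall (fun a3 =>
  bool_forall (fun a4 => bool_forall (fun b1 => bool_forall (fun b2 =>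
  bool_forall (fun b3 => bool_forall (fun b4 => bool_forall (fun c1 =>
  bool_forall (fun c2 => bool_forall (fun c3 => bool_forall (fun c4 =>
  has_zero_sum [:: (a1, b1, c1); (a2, b2, c2); (a3, b3, c3); (a4, b4, c4)]
  )))))))))))).
  by vm_compute.
move/bool_forallP/(_ a1)/bool_forallP/(_ a2)/bool_forallP/(_ a3).
move/bool_forallP/(_ a4)/bool_forallP/(_ b1)/bool_forallP/(_ b2).
move/bool_forallP/(_ b3)/bool_forallP/(_ b4)/bool_forallP/(_ c1).
by move/bool_forallP/(_ c2)/bool_forallP/(_ c3)/bool_forallP/(_ c4).
Qed.

Definition short_zero_sum (l : seq item) :=
  exists l1 l2, [/\ perm_eq l (l1 ++ l2), l1 != [::], wt_sum l1 = w0
    & (deg_sum l1 <= 7)%N].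

Lemma short_zero_sum_cat (l s t : seq item) : perm_eq l (s ++ t) ->
  has_zero_sum [seq i.1.1 | i <- s] -> (deg_sum s <= 7)%N -> short_zero_sum l.
Proof.
move=> perm_l /has_zero_sumP[m [sz_m nz_m sum0]] deg_s.
rewrite size_map in sz_m.
have perm_s := perm_mask sz_m.
exists (mask m s), (mask (map negb m) s ++ t); split.
- by apply: perm_trans perm_l _; rewrite catA perm_cat2r.
- by rewrite -size_eq0 size_mask // -lt0n -has_count.
- by move: sum0; rewrite -map_mask foldrE big_map.
- apply: leq_trans deg_s; rewrite /deg_sum (perm_big _ perm_s) big_cat /=.
  exact: leq_addr.
Qed.

(** Three quadrics fixed by C_2 have weights in C_2^2 and total degree 6.  With
    fewer of them there are at most three quadrics in all, so that any four
    factors have degree at most 7 while their weights lie in C_2^3. *)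
Lemma admissible_short_zero_sum (l : seq item) :
  admissible l -> l != [::] -> wt_sum l = w0 -> short_zero_sum l.
Proof.
move=> /andP[deg_l bad_l] nz_l sum0.
have [g3|g2] := leqP 3 (count C2_even_quadric l).
  pose g := filter C2_even_quadric l; pose h := filter (predC C2_even_quadric) l.
  have perm_gh : perm_eq l (g ++ h) by rewrite perm_sym (perm_filterC C2_even_quadric).
  have all_g : all C2_even_quadric g by apply: filter_all.
  rewrite -size_filter -/g in g3.
  case: g g3 all_g perm_gh => [|i1 [|i2 [|i3 g']]] //= _.
  case/and4P=> /andP[/eqP d1 w1] /andP[/eqP d2 w2] /andP[/eqP d3 w3] _ perm_l.
  apply: (@short_zero_sum_cat l [:: i1; i2; i3] (g' ++ h)) => //.
    exact: davenport_C2_2.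
  by rewrite /deg_sum !big_cons big_nil d1 d2 d3.
have quad_l : (count is_quadric l <= 3)%N.
  rewrite (eq_count (a2 := predU C2_even_quadric C2_odd_quadric)); last first.
    move=> i; rewrite /= /is_quadric /C2_even_quadric /C2_odd_quadric.
    by case: eqP => //= _; case: (i.1.1.2).
  apply: leq_trans (leq_add (n1 := 2) g2 bad_l).
  by rewrite -count_predUI leq_addr.
have deg_le (s : seq item) : {subset s <= l} ->
    deg_sum s = (size s + count is_quadric s)%N.
  elim: s => [|i s IH] sub; first by rewrite /deg_sum big_nil.
  rewrite /deg_sum big_cons -/(deg_sum s) IH; last first.
    by move=> j js; apply: sub; rewrite inE js orbT.
  have /(allP deg_l) : i \in l by apply: sub; rewrite inE eqxx.
  by rewrite /= /is_quadric; case/orP=> /eqP->; rewrite /= ?add0n ?add1n ?add2n addSn ?addnS.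
have [l4|l3] := leqP 4 (size l).
  apply: (@short_zero_sum_cat l (take 4 l) (drop 4 l)).
  - by rewrite cat_take_drop.
  - by case: (l) l4 => [|i1 [|i2 [|i3 [|i4 l']]]] //= _; rewrite take0 davenport_C2_3.
  - rewrite deg_le; last by move=> i; apply: mem_take.
    rewrite size_takel // (leq_add2l 4 _ 3); apply: leq_trans quad_l.
    by rewrite -[in X in (_ <= X)%N](cat_take_drop 4 l) count_cat leq_addr.
exists l, [::]; split=> //; first by rewrite cats0.
by rewrite deg_le //; apply: leq_trans (leq_add (n1 := 3) l3 quad_l) _.
Qed.

End ZeroSum.

(** * Decomposition of polynomials into weight vectors *)

(** X, Y and C stand for the actions of two generators of Q_8 and of the generator
    of C_2.  The action is a right one, so XY reads y x = x^3 y. *)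
Section UpperBound.
Variables (F : fieldType) (n : nat).
Local Notation A := {mpoly F[n]}.
Variables X Y C : {lrmorphism A -> A}.
Hypothesis two_neq0 : (2%:R : F) != 0.
Hypothesis X4 : forall f, X (X (X (X f))) = f.
Hypothesis Y2 : forall f, Y (Y f) = X (X f).
Hypothesis XY : forall f, X (Y f) = Y (X (X (X f))).
Hypothesis C2 : forall f, C (C f) = f.
Hypothesis CX : forall f, C (X f) = X (C f).
Hypothesis CY : forall f, C (Y f) = Y (C f).
Hypothesis X_homog : forall k f, f \is k.-homog -> X f \is k.-homog.
Hypothesis Y_homog : forall k f, f \is k.-homog -> Y f \is k.-homog.
Hypothesis C_homog : forall k f, f \is k.-homog -> C f \is k.-homog.

(** Twice the projection onto an eigenspace of an involution T. *)
Definition sign_part (T : A -> A) (b : bool) (f : A) : A := f + (-1) ^+ b *: T f.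

Lemma sign_part_eigen (T : {linear A -> A}) b f : T (T f) = f ->
  T (sign_part T b f) = (-1) ^+ b *: sign_part T b f.
Proof.
move=> TT; rewrite /sign_part linearD linearZ /= TT scalerDr scalerA.
by rewrite -expr2 sqrr_sign scale1r addrC.
Qed.

Lemma span_sign_part (P : A -> Prop) T f :
  (forall b, P (sign_part T b f)) -> span P f.
Proof.
move=> Pf; have -> : f = 2%:R^-1 *: sign_part T false f + 2%:R^-1 *: sign_part T true f.
  rewrite -scalerDr /sign_part expr0 expr1 scale1r scaleN1r addrACA subrr addr0.
  by rewrite -mulr2n -scaler_nat scalerA mulVf // scale1r.
by apply: span_add; apply/span_scale/span_in.
Qed.

Lemma sign_part_homog k (T : A -> A) b f :
  (forall f, f \is k.-homog -> T f \is k.-homog) ->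
  f \is k.-homog -> sign_part T b f \is k.-homog.
Proof. by move=> hT hf; apply: rpredD => //; apply/rpredZ/hT. Qed.

Definition has_weight (w : weight) (f : A) :=
  [/\ X f = (-1) ^+ w.1.1 *: f, Y f = (-1) ^+ w.1.2 *: f & C f = (-1) ^+ w.2 *: f].

Lemma has_weightM v w f g :
  has_weight v f -> has_weight w g -> has_weight (addw v w) (f * g).
Proof.
by case=> Xf Yf Cf [Xg Yg Cg]; split;
  rewrite rmorphM /= ?(Xf, Yf, Cf) ?(Xg, Yg, Cg) -scalerAl -scalerAr scalerA signr_addb.
Qed.

Definition homog_weight k (P : pred weight) (f : A) :=
  f \is k.-homog /\ exists2 w, P w & has_weight w f.

(** On the elements fixed by the central involution X^2 = Y^2 the operators X and Y
    are commuting involutions, so they can be diagonalized one after the other. *)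
Lemma even_span_weights k (b : bool) f : X (X f) = f -> C f = (-1) ^+ b *: f ->
  f \is k.-homog -> span (homog_weight k (fun w => w.2 == b)) f.
Proof.
move=> XX Cf hf.
pose P1 (a : bool) a0 := [/\ X (X a0) = a0, C a0 = (-1) ^+ b *: a0, a0 \is k.-homog
   & X a0 = (-1) ^+ a *: a0].
apply: (@span_trans _ _ (fun g => exists a, P1 a g)).
  apply: (span_sign_part (T := X)) => a; exists a; split.
  - by rewrite !sign_part_eigen // linearZ /= sign_part_eigen // scalerA -expr2 sqrr_sign scale1r.
  - rewrite /sign_part linearD linearZ /= CX Cf [X (_ *: f)]linearZ /=.
    by rewrite scalerDr !scalerA [_ ^+ a * _]mulrC.
  - exact: (sign_part_homog _ (@X_homog k)).
  - by rewrite sign_part_eigen.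
move=> {hf Cf XX} {}f [a [XX Cf hf Xf]].
have YY : Y (Y f) = f by rewrite Y2.
apply: (span_sign_part (T := Y)) => c; split; first exact: (sign_part_homog _ (@Y_homog k)).
exists (a, c, b) => //; split=> /=; last 2 first.
- by rewrite sign_part_eigen.
- rewrite /sign_part linearD linearZ /= CY Cf [Y (_ *: f)]linearZ /=.
  by rewrite scalerDr !scalerA [_ ^+ c * _]mulrC.
rewrite /sign_part linearD linearZ /= XY XX Xf [Y (_ *: f)]linearZ /=.
by rewrite scalerDr !scalerA [_ ^+ c * _]mulrC.
Qed.

Definition minus_form (b : bool) (f : A) :=
  [/\ f \is 1.-homog, X (X f) = - f & C f = (-1) ^+ b *: f].

Definition eigen_linear_form f :=
  (exists b, minus_form b f) \/ homog_weight 1 predT f.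

(** Split by the sign of C, then by the sign of the central involution; the part
    fixed by the latter is diagonalizable. *)
Lemma linear_span f : f \is 1.-homog -> span eigen_linear_form f.
Proof.
move=> hf; apply: (@span_trans _ _ (fun g => g \is 1.-homog /\
    exists b : bool, C g = (-1) ^+ b *: g)).
  apply: (span_sign_part (T := C)) => b; split; first exact: (sign_part_homog _ (@C_homog 1)).
  by exists b; apply: sign_part_eigen; apply: C2.
move=> {hf} {}f [hf [b Cf]].
pose Z : {linear A -> A} := X \o X.
have Z2 : Z (Z f) = f by rewrite /Z /= X4.
have hZ g : g \is 1.-homog -> Z g \is 1.-homog by move=> hg; do 2!apply: X_homog.
have CZ a : C (sign_part Z a f) = (-1) ^+ b *: sign_part Z a f.
  rewrite /sign_part linearD linearZ /= !CX Cf ![X (_ *: _)]linearZ /=.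
  by rewrite scalerDr !scalerA [_ ^+ a * _]mulrC.
apply: (@span_trans _ _ (fun g => exists a, g = sign_part Z a f)).
  by apply: (span_sign_part (T := Z)) => a; exists a.
move=> _ [[] ->].
  apply: span_in; left; exists b; split; [exact: (sign_part_homog _ hZ) | | exact: CZ].
  by rewrite -[X (X _)]/(Z _) sign_part_eigen // expr1 scaleN1r.
apply: (@span_trans _ _ (homog_weight 1 (fun w => w.2 == b))).
  apply: even_span_weights; [|exact: CZ|exact: (sign_part_homog _ hZ)].
  by rewrite -[X (X _)]/(Z _) sign_part_eigen // expr0 scale1r.
by move=> g [hg [w _ wg]]; apply: span_in; right; split=> //; exists w.
Qed.

(** The central involution negates both factors, hence fixes the product. *)
Lemma minus_mul_span b c f g : minus_form b f -> minus_form c g ->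
  span (homog_weight 2 (fun w => w.2 == b (+) c)) (f * g).
Proof.
move=> [hf Zf Cf] [hg Zg Cg]; apply: even_span_weights; last exact: (dhomogM hf hg).
- by rewrite !rmorphM /= Zf Zg mulrNN.
- by rewrite rmorphM /= Cf Cg -scalerAl -scalerAr scalerA signr_addb.
Qed.

Local Notation item := (item A).
Definition valid_item (i : item) := i.2 \is i.1.2.-homog /\ has_weight i.1.1 i.2.
Definition valid (l : seq item) := forall i, i \in l -> valid_item i.
Definition prod_items (l : seq item) : A := \prod_(i <- l) i.2.

Lemma valid_cons i l : valid_item i -> valid l -> valid (i :: l).
Proof. by move=> vi vl j; rewrite inE => /predU1P[->|/vl]. Qed.

Lemma prod_items_weight l : valid l -> has_weight (wt_sum l) (prod_items l).
Proof.
elim: l => [|i l IH] vl.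
  by rewrite /wt_sum /prod_items !big_nil; split; rewrite rmorph1 scale1r.
rewrite /wt_sum /prod_items !big_cons; apply: has_weightM.
  by have [] := vl i (mem_head _ _).
by apply: IH => j jl; apply: vl; rewrite inE jl orbT.
Qed.

Lemma prod_items_homog l : valid l -> prod_items l \is (deg_sum l).-homog.
Proof.
elim: l => [|i l IH] vl; first by rewrite /deg_sum /prod_items !big_nil dhomog1.
rewrite /deg_sum /prod_items !big_cons; apply: dhomogM.
  by have [] := vl i (mem_head _ _).
by apply: IH => j jl; apply: vl; rewrite inE jl orbT.
Qed.

Definition fixed_by_generators f := [/\ X f = f, Y f = f & C f = f].
Definition fixed_homog_le d f :=
  fixed_by_generators f /\ exists2 k, (k <= d)%N & f \is k.-homog.

(** The zero-sum factor of degree at most 7 is an invariant and the complementary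
    factor is again an admissible zero-sum product. *)
Lemma zero_sum_generated l : admissible l -> valid l -> wt_sum l = w0 ->
  generated_subalgebra (fixed_homog_le 7) (prod_items l).
Proof.
have [m] := ubnP (size l); elim: m l => // m IH l sz_l adm_l val_l sum_l.
have [-> | nz_l] := eqVneq l [::]; first by rewrite /prod_items big_nil; apply: GenOne.
have [l1 [l2 [perm_l nz1 sum1 deg1]]] := admissible_short_zero_sum adm_l nz_l sum_l.
have sum2 : wt_sum l2 = w0.
  by move: sum_l; rewrite /wt_sum (perm_big _ perm_l) big_cat /= -/(wt_sum l1) sum1 add0w.
have [sub1 sub2] : {subset l1 <= l} /\ {subset l2 <= l}.
  by split=> i il; rewrite (perm_mem perm_l) mem_cat il ?orbT.
have val1 : valid l1 by move=> i /sub1/val_l.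
rewrite /prod_items (perm_big _ perm_l) big_cat /=; apply: GenMul.
  apply: GenSub; split; last by exists (deg_sum l1); rewrite ?prod_items_homog.
  by have := prod_items_weight val1; rewrite sum1 => -[/=]; rewrite !scale1r; split.
apply: IH => //; last by move=> i /sub2/val_l.
  rewrite -ltnS; apply: leq_trans sz_l; rewrite ltnS (perm_size perm_l) size_cat.
  by rewrite -[in X in (X <= _)%N](add0n (size l2)) ltn_add2r lt0n size_eq0.
move: adm_l; rewrite /admissible (perm_all _ perm_l) (seq.permP perm_l) all_cat count_cat.
by case/andP=> /andP[_ ->] /(leq_trans (leq_addl _ _)) ->.
Qed.

Definition C2_even_quadrics (l : seq item) :=
  all (fun i => (i.1.2 == 1) || (i.1.2 == 2)) l && ~~ has (@C2_odd_quadric A) l.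

(** s0 and s1 are the minus forms of each C_2-sign still waiting for a partner. *)
Definition normal_form f := exists s0 s1 l,
  [/\ f = s0 * s1 * prod_items l, s0 = 1 \/ minus_form false s0,
      s1 = 1 \/ minus_form true s1, valid l & C2_even_quadrics l].

Lemma normal_form_consQ s0 s1 l f :
  s0 = 1 \/ minus_form false s0 -> s1 = 1 \/ minus_form true s1 ->
  valid l -> C2_even_quadrics l ->
  homog_weight 1 predT f \/ homog_weight 2 (fun w => w.2 == false) f ->
  normal_form (s0 * s1 * (f * prod_items l)).
Proof.
move=> h0 h1 vl bl hf.
have [k [w [hk hw wf bw]]] : exists k w, [/\ f \is k.-homog, (k == 1) || (k == 2),
    has_weight w f & ~~ ((k == 2) && w.2)].
  by case: hf => -[hf [w bw wf]]; [exists 1, w | exists 2, w; rewrite (eqP bw)].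
exists s0, s1, ((w, k, f) :: l); split=> //.
- by rewrite /prod_items big_cons.
- by apply: valid_cons.
- by move: bl; rewrite /C2_even_quadrics /= hw [C2_odd_quadric _]/C2_odd_quadric /= (negPf bw).
Qed.

(** A new minus form is paired with the waiting one of its own C_2-sign, which only
    produces quadrics fixed by C_2, or else becomes the waiting one. *)
Lemma normal_form_mul f g : eigen_linear_form f -> normal_form g ->
  span normal_form (f * g).
Proof.
case=> [[b mf]|hf] [s0 [s1 [l [-> h0 h1 vl bl]]]]; last first.
  rewrite mulrCA; apply: span_in; apply: normal_form_consQ => //; by left.
case: b mf => mf.
  case: (h1) => [-> | m1].
    rewrite mulr1 mulrCA mulrA; apply: span_in.
    by exists s0, f, l; split=> //; right.
  have -> : f * (s0 * s1 * prod_items l) = f * s1 * (s0 * prod_items l).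
    by rewrite [s0 * s1]mulrC !mulrA.
  apply: (span_mul (minus_mul_span mf m1) (span_in (P := eq (s0 * prod_items l)) erefl)).
  move=> q _ hq <-; rewrite mulrCA -[s0]mulr1; apply: span_in.
  by apply: normal_form_consQ => //; [left | right].
case: (h0) => [-> | m0].
  rewrite mul1r mulrA; apply: span_in.
  by exists f, s1, l; split=> //; right.
have -> : f * (s0 * s1 * prod_items l) = f * s0 * (s1 * prod_items l).
  by rewrite !mulrA.
apply: (span_mul (minus_mul_span mf m0) (span_in (P := eq (s1 * prod_items l)) erefl)).
move=> q _ hq <-; rewrite mulrCA -[s1]mul1r; apply: span_in.
by apply: normal_form_consQ => //; [left | right].
Qed.

Lemma span_normal_form f : span normal_form f.
Proof.
elim/mpolyind: f => [|c m f _ _ Sf]; first by left.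
apply: span_add => //; apply: span_scale => {c f Sf}.
pose stable h := forall g, span normal_form g -> span normal_form (h * g).
(* Multiplication by linear forms is under control, and being a stable multiplier is
   inherited by products. *)
suff st : stable 'X_[m].
  rewrite -[X in span _ X]mulr1; apply/st/span_in; exists 1, 1, [::].
  by split=> //; [rewrite /prod_items big_nil !mulr1 | left | left].
have st1 : stable 1 by move=> g; rewrite mul1r.
have stM h1 h2 : stable h1 -> stable h2 -> stable (h1 * h2).
  by move=> s1 s2 g Sg; rewrite -mulrA; apply/s1/s2.
rewrite mpolyXE_id; apply: (big_ind stable) => // i _.
elim: (m i) => [|k IH]; first by rewrite expr0.
rewrite exprS; apply: stM IH => g Sg.
have hX : ('X_i : A) \is 1.-homog by rewrite dhomogX /= mdeg1.
exact: (span_mul (linear_span hX) Sg normal_form_mul).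
Qed.

(** The first alternative is what a single unpaired minus form leads to. *)
Definition final_form f :=
  X (X f) = - f \/ exists l, [/\ f = prod_items l, valid l & admissible l].

Lemma normal_form_final f : normal_form f -> span final_form f.
Proof.
case=> s0 [s1 [l [-> h0 h1 vl /andP[dl bl]]]].
have cb : count (@C2_odd_quadric A) l = 0%N.
  by move: bl; rewrite has_count -eqn0Ngt => /eqP.
have Zl : X (X (prod_items l)) = prod_items l.
  have [Xl _ _] := prod_items_weight vl.
  by rewrite Xl linearZ /= Xl scalerA -expr2 sqrr_sign scale1r.
case: h0 h1 => [-> | m0] [-> | m1].
- rewrite !mul1r; apply: span_in; right; exists l; split=> //.
  by rewrite /admissible dl cb.
- rewrite mul1r; apply: span_in; left.
  by case: m1 => _ Z1 _; rewrite !rmorphM /= Zl Z1 mulNr.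
- rewrite mulr1; apply: span_in; left.
  by case: m0 => _ Z0 _; rewrite !rmorphM /= Zl Z0 mulNr.
apply: (span_mul (minus_mul_span m0 m1) (span_in (P := eq (prod_items l)) erefl)).
move=> q _ [hq [w /= wb wq]] <-; apply: span_in; right; exists ((w, 2, q) :: l).
split; first by rewrite /prod_items big_cons.
  exact: valid_cons.
by rewrite /admissible /= dl cb addn0 leq_b1.
Qed.

Definition average (T : A -> A) (f : A) : A := 2%:R^-1 *: (f + T f).
(** The average over the group.  The central involution must be averaged first:
    X and Y are commuting involutions only on its fixed space. *)
Definition reynolds f := average C (average X (average Y (average (X \o X) f))).

Lemma average_eigen (T : A -> A) (b : bool) f :
  T f = (-1) ^+ b *: f -> average T f = if b then 0 else f.
Proof.
move=> Tf; rewrite /average Tf; case: b {Tf}.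
  by rewrite expr1 scaleN1r subrr scaler0.
by rewrite expr0 scale1r -mulr2n -scaler_nat scalerA mulVf // scale1r.
Qed.

Lemma averageP (T : {linear A -> A}) c f g :
  average T (c *: f + g) = c *: average T f + average T g.
Proof.
by rewrite /average linearP /= addrACA -scalerDr [LHS]scalerDr !scalerA mulrC.
Qed.

Lemma reynoldsP c f g : reynolds (c *: f + g) = c *: reynolds f + reynolds g.
Proof. by rewrite /reynolds (averageP (X \o X)) !averageP. Qed.

Lemma average_id (T : A -> A) f : T f = f -> average T f = f.
Proof. by move=> Tf; rewrite (@average_eigen T false) // Tf scale1r. Qed.

Lemma reynolds_fixed f : fixed_by_generators f -> reynolds f = f.
Proof. by case=> Xf Yf Cf; rewrite /reynolds !average_id //= Xf. Qed.

Lemma average_fixed (T : {linear A -> A}) f :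
  T (T f) = f -> T (average T f) = average T f.
Proof. by move=> TT; rewrite /average linearZ /= linearD /= TT addrC. Qed.

Lemma fixed_by_generators_reynolds f : fixed_by_generators (reynolds f).
Proof.
rewrite /reynolds; set f0 := average (X \o X) f.
have Z0 : X (X f0) = f0 by apply: (average_fixed (T := X \o X)); apply: X4.
set f1 := average Y f0.
have Y1 : Y f1 = f1 by apply: average_fixed; apply: etrans (Y2 _) Z0.
have Z1 : X (X f1) = f1 by rewrite -Y2 !Y1.
set f2 := average X f1.
have X2 : X f2 = f2 by apply: average_fixed.
have YX1 : Y (X f1) = X f1 by rewrite -[in RHS]Y1 XY Z1.
have Y3 : Y f2 = f2 by rewrite [LHS]linearZ /= linearD /= Y1 YX1.
split; last by apply: average_fixed; apply: C2.
  by rewrite [LHS]linearZ /= linearD /= -CX X2.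
by rewrite [LHS]linearZ /= linearD /= -CY Y3.
Qed.

Lemma generated0 : generated_subalgebra (fixed_homog_le 7) 0.
Proof.
by apply: GenSub; split; [split; apply: linear0 | exists 0; rewrite ?dhomog0].
Qed.

(** On a weight vector the average is the identity or zero, according to whether
    the weight is zero. *)
Lemma reynolds_final f : final_form f ->
  generated_subalgebra (fixed_homog_le 7) (reynolds f).
Proof.
have gen0 := generated0.
case=> [Zf | [l [-> vl al]]].
  rewrite /reynolds (@average_eigen (X \o X) true) /=; last by rewrite expr1 scaleN1r.
  by rewrite !average_id ?linear0.
have [Xl Yl Cl] := prod_items_weight vl.
case def_w : (wt_sum l) Xl Yl Cl => [[a b] c] /= Xl Yl Cl.
rewrite /reynolds (@average_id (X \o X)) /=; last first.
  by rewrite Xl linearZ /= Xl scalerA -expr2 sqrr_sign scale1r.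
rewrite (average_eigen Yl); case: b {Yl} def_w => def_w.
  by rewrite !average_id ?linear0.
rewrite (average_eigen Xl); case: a {Xl} def_w => def_w.
  by rewrite !average_id ?linear0.
rewrite (average_eigen Cl); case: c {Cl} def_w => def_w //.
exact: zero_sum_generated.
Qed.

Lemma generated_le7 f : fixed_by_generators f -> generated_subalgebra (fixed_homog_le 7) f.
Proof.
move/reynolds_fixed <-.
elim: (span_trans (span_normal_form f) normal_form_final) => [|c a b Fa _ IH].
  rewrite reynolds_fixed; first exact: generated0.
  by split; apply: linear0.
by rewrite reynoldsP; apply: GenLin => //; apply: reynolds_final.
Qed.

End UpperBound.

(** * The action on the symmetric algebra *)

Section SymAct.
Variables (F : fieldType) (gT : finGroupType) (G : {group gT}) (n : nat).
Variable rG : mx_representation F G n.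

HB.instance Definition _ (g : gT) := GRing.LRMorphism.copy (sym_act rG g)
  (comp_mpoly [tuple \sum_(j < n) rG g i j *: 'X_j | i < n]).

Lemma sym_actX g i : sym_act rG g 'X_i = \sum_(j < n) rG g i j *: 'X_j.
Proof. by rewrite /sym_act comp_mpolyXU -tnth_nth tnth_mktuple. Qed.

Lemma rmorph_mpoly_eq (A : comAlgType F) (f g : {lrmorphism {mpoly F[n]} -> A}) :
  (forall i, f 'X_i = g 'X_i) -> f =1 g.
Proof.
move=> fg; elim/mpolyind=> [|c m p _ _ IH]; first by rewrite !linear0.
rewrite !linearP /= IH; congr (_ *: _ + _).
rewrite mpolyXE_id !rmorph_prod; apply: eq_bigr => i _.
by rewrite !rmorphXn /= fg.
Qed.

Lemma sym_act1 f : sym_act rG 1%g f = f.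
Proof.
move: f; apply: (rmorph_mpoly_eq (g := idfun)) => i /=.
rewrite sym_actX repr_mx1 (bigD1 i) //= mxE eqxx scale1r big1 ?addr0 // => j ji.
by rewrite mxE eq_sym (negPf ji) scale0r.
Qed.

(** The order of the factors is reversed because coordinates are rows, on which
    the matrices act from the right. *)
Lemma sym_actM g h f : g \in G -> h \in G ->
  sym_act rG (g * h)%g f = sym_act rG h (sym_act rG g f).
Proof.
move=> gG hG; move: f.
apply: (rmorph_mpoly_eq (g := sym_act rG h \o sym_act rG g)) => i /=.
rewrite !sym_actX linear_sum /= repr_mxM //.
under [RHS]eq_bigr do rewrite linearZ /= sym_actX scaler_sumr.
rewrite exchange_big /=; apply: eq_bigr => j _.
rewrite mxE scaler_suml; apply: eq_bigr => k _.
by rewrite scalerA.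
Qed.

Lemma sym_act_homog g k f : f \is k.-homog -> sym_act rG g f \is k.-homog.
Proof.
move/dhomogP=> hf; rewrite (mpolyE f) linear_sum /= big_seq.
apply: rpred_sum => m /hf <-; rewrite linearZ; apply: rpredZ.
rewrite mpolyXE_id rmorph_prod /= mdegE.
elim/big_ind2: _ => [|k1 f1 k2 f2|i _]; [exact: dhomog1|exact: dhomogM|].
have hX : sym_act rG g 'X_i \is 1.-homog.
  by rewrite sym_actX; apply: rpred_sum => j _; rewrite rpredZ // dhomogX /= mdeg1.
by have := dhomogMn (m i) hX; rewrite mul1n rmorphXn.
Qed.

End SymAct.

Lemma Q8xC2_full (g : 'Q_8 * 'Z_2) : g \in Q8xC2.
Proof. by case: g => a b; rewrite inE /= !inE. Qed.

(** * The upper bound for the group Q_8 x C_2 *)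

Section Generators.
Variables x y : 'Q_8.
Hypothesis xy : quaternion_pair x y.
Let gx : 'Q_8 * 'Z_2 := (x, 1%g).
Let gy : 'Q_8 * 'Z_2 := (y, 1%g).
Let gc : 'Q_8 * 'Z_2 := (1%g, Zp1).

Lemma Q8xC2_ind (P : 'Q_8 * 'Z_2 -> Prop) :
  P 1%g -> (forall g, P g -> P (g * gx)%g) -> (forall g, P g -> P (g * gy)%g) ->
  (forall g, P g -> P (g * gc)%g) -> forall g, P g.
Proof.
have [_ _ _ gen] := xy => P1 Px Py Pc [q e].
have [[a b] ->] := gen q.
have PX h k : P h -> P (h * gx ^+ k)%g.
  by move=> Ph; elim: k => [|k IH]; rewrite ?mulg1 // expgSr mulgA; apply: Px.
have PY h k : P h -> P (h * gy ^+ k)%g.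
  by move=> Ph; elim: k => [|k IH]; rewrite ?mulg1 // expgSr mulgA; apply: Py.
have PC h k : P h -> P (h * gc ^+ k)%g.
  by move=> Ph; elim: k => [|k IH]; rewrite ?mulg1 // expgSr mulgA; apply: Pc.
have := PC _ e (PY _ b (PX _ a P1)).
have expP (g : 'Q_8) (h : 'Z_2) k : ((g, h) ^+ k)%g = (g ^+ k, h ^+ k)%g :> 'Q_8 * 'Z_2.
  by elim: k => [|k IH] //; rewrite !expgS IH.
rewrite mul1g !expP !expg1n; congr P; congr (_, _).
  by rewrite /= mulg1.
by rewrite /= !mul1g; apply: val_inj; case: e => [[|[|[]]]].
Qed.

Variables (F : fieldType) (n : nat) (rG : mx_representation F Q8xC2 n).
Hypothesis two_neq0 : (2%:R : F) != 0.
Local Notation act := (sym_act rG).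

Let actM g h f : act g (act h f) = act (h * g)%g f.
Proof. by rewrite (sym_actM _ _ (Q8xC2_full h) (Q8xC2_full g)). Qed.

Lemma sym_invariantP f : sym_invariant rG f <-> fixed_by_generators (act gx) (act gy) (act gc) f.
Proof.
split=> [inv | [fx fy fc]]; first by split; apply: inv; apply: Q8xC2_full.
move=> g _; elim/Q8xC2_ind: g => [|g IH|g IH|g IH]; first exact: sym_act1.
- by rewrite -actM IH fx.
- by rewrite -actM IH fy.
- by rewrite -actM IH fc.
Qed.

Let pairM (q r : 'Q_8) (d e : 'Z_2) : ((q, d) * (r, e) = (q * r, d * e))%g.
Proof. by []. Qed.

Lemma act_x4 f : act gx (act gx (act gx (act gx f))) = f.
Proof.
have [x4 _ _ _] := xy.
have e : (gx * (gx * (gx * gx)) = 1)%g.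
  by move: x4; rewrite /gx !pairM !expgS expg0 !mulg1 => ->.
by rewrite !actM e sym_act1.
Qed.

Lemma act_y2 f : act gy (act gy f) = act gx (act gx f).
Proof.
have [_ y2 _ _] := xy.
have e : (gy * gy = gx * gx)%g by move: y2; rewrite /gx /gy !pairM !expgS expg0 !mulg1 => ->.
by rewrite !actM e.
Qed.

Lemma act_xy f : act gx (act gy f) = act gy (act gx (act gx (act gx f))).
Proof.
have [_ _ yx _] := xy.
have e : (gy * gx = gx * (gx * (gx * gy)))%g.
  by rewrite /gx /gy !pairM !mulg1 yx !expgS expg0 mulg1 !mulgA.
by rewrite !actM e !mulgA.
Qed.

Lemma act_c2 f : act gc (act gc f) = f.
Proof.
have e : (gc * gc = 1)%g by rewrite /gc pairM mulg1; congr (_, _); apply: val_inj.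
by rewrite actM e sym_act1.
Qed.

Lemma act_cx f : act gc (act gx f) = act gx (act gc f).
Proof.
have e : (gx * gc = gc * gx)%g by rewrite /gx /gc !pairM !mulg1 !mul1g.
by rewrite !actM e.
Qed.

Lemma act_cy f : act gc (act gy f) = act gy (act gc f).
Proof.
have e : (gy * gc = gc * gy)%g by rewrite /gy /gc !pairM !mulg1 !mul1g.
by rewrite !actM e.
Qed.

Lemma invariants_generated_le7 : invariants_generated_upto rG 7.
Proof.
move=> f /sym_invariantP inv_f.
have := @generated_le7 F n (act gx) (act gy) (act gc) two_neq0 act_x4 act_y2
  act_xy act_c2 act_cx act_cy _ _ _ f inv_f.
move/(_ (@sym_act_homog _ _ _ _ _ _) (@sym_act_homog _ _ _ _ _ _) (@sym_act_homog _ _ _ _ _ _)).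
elim=> [g [/sym_invariantP inv_g hg] | |c a b _ IHa _ IHb|a b _ IHa _ IHb].
- exact: GenSub.
- exact: GenOne.
- exact: GenLin.
- exact: GenMul.
Qed.

End Generators.

(** A set of natural numbers containing b has a least element; as the property is
    undecided this is a classical statement. *)
Lemma is_beta_ex (F : fieldType) (gT : finGroupType) (G : {group gT}) n
    (rG : mx_representation F G n) b :
  invariants_generated_upto rG b -> exists2 d, is_beta rG d & (d <= b)%N.
Proof.
elim: b {-2}b (leqnn b) => [|k IH] b; last first.
  move=> le_bk gen_b.
  case: (classic (exists2 e, (e < b)%N & invariants_generated_upto rG e)) => [[e lt_eb gen_e]|nex].
    have [|d beta_d le_de] := IH e _ gen_e; first by rewrite -ltnS (leq_trans lt_eb).
    by exists d => //; apply: leq_trans le_de (ltnW lt_eb).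
  exists b => //; split=> // e gen_e; rewrite leqNgt; apply/negP=> lt_eb.
  by apply: nex; exists e.
by rewrite leqn0 => /eqP-> gen0; exists 0%N.
Qed.

(** * Representations from matrices satisfying the relations *)

Section BuildRepresentation.
Variables (x y : 'Q_8) (F : fieldType) (n : nat).
Hypothesis xy : quaternion_pair x y.
Variables X Y C : 'M[F]_n.+1.
Hypotheses (X4 : X ^+ 4 = 1) (Y2 : Y ^+ 2 = X ^+ 2) (YX : Y * X = X ^+ 3 * Y).
Hypotheses (C2 : C ^+ 2 = 1) (CX : C * X = X * C) (CY : C * Y = Y * C).

Lemma word_exists (g : 'Q_8) :
  exists ab : 'I_4 * 'I_2, g == (x ^+ ab.1 * y ^+ ab.2)%g.
Proof. by have [_ _ _ gen] := xy; have [ab ->] := gen g; exists ab. Qed.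

(** As the normal form x^a y^b of an element is unique, matrices satisfying the
    relations of x and y extend to the group by X^a Y^b. *)
Definition exponents (g : 'Q_8) := xchoose (word_exists g).
Definition quaternion_mx (g : 'Q_8) := X ^+ (exponents g).1 * Y ^+ (exponents g).2.

(** Matrices and group elements satisfy the same relations, so both words reduce
    to the same normal form, which is unique on the group side. *)
Lemma quaternion_mxE (a b : nat) : quaternion_mx (x ^+ a * y ^+ b)%g = X ^+ a * Y ^+ b.
Proof.
have [x4 y2 _ _] := xy.
pose k := (a + 2 * b./2)%N.
have gE := quaternion_word_reduce a b x4 y2; rewrite -/k in gE.
have mE : X ^+ a * Y ^+ b = X ^+ (k %% 4)%N * Y ^+ (b %% 2)%N.
  have -> : X ^+ (k %% 4)%N = X ^+ k.
    by rewrite [in RHS](divn_eq k 4) exprD mulnC exprM X4 expr1n mul1r.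
  rewrite /k exprD exprM -Y2 -exprM -mulrA -exprD; congr (_ * _ ^+ _).
  by rewrite modn2 addnC mul2n odd_double_half.
rewrite gE mE /quaternion_mx /exponents; set ex := word_exists _.
have /eqP := xchooseP ex.
have := @quaternion_normal_form_inj x y xy (inord (k %% 4), inord (b %% 2)) (xchoose ex).
by rewrite /= !inordK ?ltn_mod // => inj /inj <- /=; rewrite !inordK ?ltn_mod.
Qed.

Lemma quaternion_mxM g h : quaternion_mx (g * h)%g = quaternion_mx g * quaternion_mx h.
Proof.
have [x4 y2 yx gen] := xy.
have [[a b] ->] := gen g; have [[c d] ->] := gen h; rewrite /= !quaternion_mxE.
have yxc e : (y * x ^+ e = x ^+ (3 * e)%N * y)%g.
  elim: e => [|e IH]; first by rewrite muln0 mulg1 mul1g.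
  by rewrite expgSr mulgA IH -mulgA yx mulgA -expgD mulnSr.
have ybx k e : (y ^+ k * x ^+ e = x ^+ (3 ^ k * e)%N * y ^+ k)%g.
  elim: k => [|k IH]; first by rewrite mulg1 mul1g mul1n.
  by rewrite expgS -mulgA IH mulgA yxc -mulgA mulnA -expnS.
have YXc e : Y * X ^+ e = X ^+ (3 * e)%N * Y.
  elim: e => [|e IH]; first by rewrite muln0 mulr1 mul1r.
  by rewrite exprSr mulrA IH -mulrA YX mulrA -exprD mulnSr.
have YbX k e : Y ^+ k * X ^+ e = X ^+ (3 ^ k * e)%N * Y ^+ k.
  elim: k => [|k IH]; first by rewrite mulr1 mul1r mul1n.
  by rewrite exprS -mulrA IH mulrA YXc -mulrA mulnA -expnS.
rewrite mulgA -(mulgA (x ^+ a)%g) ybx (mulgA (x ^+ a)%g) -expgD -mulgA -expgD quaternion_mxE.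
by rewrite mulrA -(mulrA (X ^+ a)) YbX (mulrA (X ^+ a)) -exprD -mulrA -exprD.
Qed.

Definition product_mx (g : 'Q_8 * 'Z_2) : 'M[F]_n.+1 := quaternion_mx g.1 * C ^+ g.2.

Lemma product_mx_repr : mx_repr Q8xC2 product_mx.
Proof.
split=> [|g h _ _].
  by rewrite /product_mx /= -[1%g](mulg1 (x ^+ 0)%g) (quaternion_mxE 0 0) !mulr1.
rewrite /product_mx /= quaternion_mxM.
have Cq e q : GRing.comm (C ^+ e) (quaternion_mx q).
  by apply/commr_sym/commrX/commr_sym/commrM; apply: commrX.
have -> : C ^+ (g.2 * h.2)%g = C ^+ g.2 * C ^+ h.2.
  rewrite -exprD /= [in RHS](divn_eq (g.2 + h.2) 2) exprD mulnC exprM C2 expr1n mul1r.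
  by [].
rewrite -[_ *m _]/(_ * _); have := Cq g.2 h.1.
move: (quaternion_mx _) (quaternion_mx _) (C ^+ _) (C ^+ _) => a b c d bc.
by rewrite -!mulrA; congr (_ * _); rewrite !mulrA bc.
Qed.

Definition product_repr := MxRepresentation product_mx_repr.

Lemma product_repr_x : product_repr (x, 1%g) = X.
Proof.
by rewrite /= /product_mx /= -[x](mulg1 (x ^+ 1)%g) (quaternion_mxE 1 0) !mulr1.
Qed.
Lemma product_repr_y : product_repr (y, 1%g) = Y.
Proof.
by rewrite /= /product_mx /= -[y](mul1g (y ^+ 1)%g) (quaternion_mxE 0 1) mulr1 mul1r.
Qed.
Lemma product_repr_c : product_repr (1%g, Zp1) = C.
Proof.
by rewrite /= /product_mx /= -[1%g](mulg1 (x ^+ 0)%g) (quaternion_mxE 0 0) mulr1 mul1r.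
Qed.
End BuildRepresentation.

(** * A module of dimension 9 *)

(** The matrices of the module have exactly one nonzero entry, 1 or -1, in each row;
    the row i is recorded as a pair (is the entry -1, its column), so that
    relations between such matrices can be checked by computation. *)
Section SignedPermutations.
Variables (F : fieldType) (n : nat).
Definition signed_entry (s : seq (bool * nat)) i := nth (false, 0%N) s i.
Definition signed_perm_mx (s : seq (bool * nat)) : 'M[F]_n.+1 :=
  \matrix_(i, j) (if (signed_entry s i).2 == j then (-1) ^+ (signed_entry s i).1 else 0).
Definition signed_comp (s t : seq (bool * nat)) :=
  [seq (p.1 (+) (signed_entry t p.2).1, (signed_entry t p.2).2) | p <- s].
Definition signed_wf (s : seq (bool * nat)) :=
  (size s == n.+1) && all (fun p => p.2 < n.+1)%N s.

Lemma signed_perm_sum (S : comNzRingType) (k : {rmorphism F -> S}) s (f : nat -> S)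
    (i : 'I_n.+1) : signed_wf s ->
  \sum_(j < n.+1) k (signed_perm_mx s i j) * f j =
  (-1) ^+ (signed_entry s i).1 * f (signed_entry s i).2.
Proof.
case/andP=> /eqP sz /allP wf.
have lt : ((signed_entry s i).2 < n.+1)%N by apply/wf/mem_nth; rewrite sz.
rewrite (bigD1 (Ordinal lt)) //= mxE eqxx big1 ?addr0 => [|j nj].
  by rewrite rmorph_sign.
rewrite mxE ifF ?rmorph0 ?mul0r //; apply/negbTE; apply: contra nj => /eqP ej.
by apply/eqP/val_inj.
Qed.

Lemma signed_perm_mxM s t : signed_wf s ->
  signed_perm_mx s * signed_perm_mx t = signed_perm_mx (signed_comp s t).
Proof.
move=> wf; apply/matrixP=> i k; rewrite !mxE.
pose f (j : nat) : F := if (signed_entry t j).2 == k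
  then (-1) ^+ (signed_entry t j).1 else 0.
transitivity (\sum_(j < n.+1) signed_perm_mx s i j * f j).
  by apply: eq_bigr => j _; rewrite [in LHS](mxE _ _ j k).
rewrite (signed_perm_sum idfun) // /f.
have -> : signed_entry (signed_comp s t) i =
    ((signed_entry s i).1 (+) (signed_entry t (signed_entry s i).2).1,
     (signed_entry t (signed_entry s i).2).2).
  by rewrite /signed_entry (nth_map (false, 0%N)) //; case/andP: wf => /eqP->.
rewrite /=; case: eqP => _; last by rewrite mulr0.
by rewrite signr_addb.
Qed.
End SignedPermutations.

Lemma signed_perm_mx1 (F : fieldType) n :
  signed_perm_mx F n [seq (false, i) | i <- iota 0 n.+1] = 1.
Proof.
apply/matrixP=> i j; rewrite !mxE /signed_entry (nth_map 0%N) ?size_iota //.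
rewrite nth_iota // add0n /= expr0; case: (i =P j) => [->|/eqP ij]; first by rewrite eqxx.
by rewrite ifF // -[in RHS](negbTE ij).
Qed.

Section WitnessModule.
Variables (x y : 'Q_8) (F : fieldType).
Hypothesis xy : quaternion_pair x y.

(** The basis is X, iX, Y, iY, X', iX', Y', iY', t.  The first generator of Q_8
    multiplies X, X' by i and Y, Y' by -i; the second sends X to Y and Y to -X, and
    likewise X' to Y' and Y' to -X'; the generator of C_2 negates the primed
    vectors and t. *)
Definition perm_x := [:: (false, 1); (true, 0); (true, 3); (false, 2);
                         (false, 5); (true, 4); (true, 7); (false, 6); (false, 8)]%N.
Definition perm_y := [:: (false, 2); (false, 3); (true, 0); (true, 1);
                         (false, 6); (false, 7); (true, 4); (true, 5); (false, 8)]%N.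
Definition perm_c := [:: (false, 0); (false, 1); (false, 2); (false, 3);
                         (true, 4); (true, 5); (true, 6); (true, 7); (true, 8)]%N.
Local Notation mx := (signed_perm_mx F 8).

Lemma witness_relations :
  [/\ mx perm_x ^+ 4 = 1, mx perm_y ^+ 2 = mx perm_x ^+ 2,
      mx perm_y * mx perm_x = mx perm_x ^+ 3 * mx perm_y,
      mx perm_c ^+ 2 = 1
    & mx perm_c * mx perm_x = mx perm_x * mx perm_c /\
      mx perm_c * mx perm_y = mx perm_y * mx perm_c].
Proof.
have wx : signed_wf 8 perm_x by [].
have wy : signed_wf 8 perm_y by [].
have wc : signed_wf 8 perm_c by [].
split; rewrite ?exprS ?expr0 ?mulr1 ?mulrA !signed_perm_mxM //.
- by rewrite -[RHS]signed_perm_mx1.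
- by rewrite -[RHS]signed_perm_mx1.
Qed.

Lemma witness_module : exists rG : mx_representation F Q8xC2 9,
  [/\ rG (x, 1%g) = mx perm_x, rG (y, 1%g) = mx perm_y & rG (1%g, Zp1) = mx perm_c].
Proof.
have [X4 Y2 YX C2 [CX CY]] := witness_relations.
exists (product_repr xy X4 Y2 YX C2 CX CY).
by split; [apply: product_repr_x | apply: product_repr_y | apply: product_repr_c].
Qed.
End WitnessModule.

(** * Adjoining a square root of -1 *)

Lemma sqrtN1_extension (F : fieldType) :
  exists (K : fieldType) (iota : {rmorphism F -> K}) (r : K), r ^+ 2 = -1.
Proof.
pose p : {poly F} := 'X^2 + 1.
have sz_p : size p = 3 by rewrite size_polyDl ?size_polyXn ?size_poly1.
case: (classic (exists r : F, r ^+ 2 = -1)) => [[r r2]|nr].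
  by exists F, idfun, r.
have irr_p : irreducible_poly p.
  apply: cubic_irreducible; first by rewrite sz_p.
  move=> r; apply/negP=> /rootP; rewrite /p !hornerE => /eqP.
  by rewrite addr_eq0 => /eqP r2; apply: nr; exists r.
have [L _ [z rz _]] := irredp_FAdjoin irr_p.
exists L, (in_alg L), z; apply/eqP; rewrite -addr_eq0.
by move: rz; rewrite /p rmorphD rmorph1 /= map_polyXn rootE !hornerE.
Qed.

(** * Rescaling and evaluating polynomials *)

Section Scaling.
Variable R : comNzRingType.

Definition scale_var (a : R) : {poly R} -> {poly R} := comp_poly (a *: 'X).
HB.instance Definition _ a := GRing.RMorphism.copy (scale_var a) (comp_poly (a *: 'X)).

Lemma coef_scale_var a p k : (scale_var a p)`_k = a ^+ k * p`_k.
Proof.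
elim/poly_ind: p k => [|p c IH] k; first by rewrite rmorph0 coef0 mulr0.
rewrite /scale_var rmorphD rmorphM /= comp_polyX comp_polyC -scalerAr !coefD !coefC.
rewrite coefZ !coefMX; case: k => [|k] /=; first by rewrite mulr0 expr0 mul1r !add0r.
by rewrite -/(scale_var a p) IH exprS mulrA !addr0.
Qed.

Lemma scale_varC a c : scale_var a c%:P = c%:P.
Proof. exact: comp_polyC. Qed.
Lemma scale_varX a : scale_var a 'X = a *: 'X.
Proof. exact: comp_polyX. Qed.
End Scaling.

Lemma mmap_rmorph (n : nat) (R S T : comNzRingType) (k : {rmorphism R -> S})
    (phi : {rmorphism S -> T}) (h : 'I_n -> S) (p : {mpoly R[n]}) :
  phi (mmap k h p) = mmap (phi \o k) (phi \o h) p.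
Proof.
rewrite /mmap rmorph_sum; apply: eq_bigr => m _ /=.
rewrite rmorphM rmorph_prod; congr (_ * _); apply: eq_bigr => i _.
by rewrite rmorphXn.
Qed.

Lemma mmap_ext (n : nat) (R S : comNzRingType) (k k' : R -> S)
    (h h' : 'I_n -> S) (p : {mpoly R[n]}) :
  k =1 k' -> h =1 h' -> mmap k h p = mmap k' h' p.
Proof.
move=> kk hh; rewrite /mmap; apply: eq_bigr => m _.
by rewrite kk (mmap1_eq _ hh).
Qed.

Lemma mmap_sym_act (F : fieldType) (gT : finGroupType) (G : {group gT}) n
    (rG : mx_representation F G n) (S : comNzRingType) (k : {rmorphism F -> S})
    (h : 'I_n -> S) g (p : {mpoly F[n]}) :
  mmap k h (sym_act rG g p) = mmap k (fun i => \sum_(j < n) k (rG g i j) * h j) p.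
Proof.
rewrite /sym_act /comp_mpoly.
rewrite (mmap_rmorph (@mpolyC n F) (mmap k h)); apply: mmap_ext => [c|i] /=.
  by rewrite mmapC.
rewrite tnth_mktuple rmorph_sum /=; apply: eq_bigr => j _.
by rewrite mmapZ mmapX mmap1U.
Qed.

Lemma mmap_homog (n : nat) (R S : comNzRingType) (k : {rmorphism R -> S})
    (h : 'I_n -> S) (a : S) d (p : {mpoly R[n]}) : p \is d.-homog ->
  mmap k (fun i => a * h i) p = a ^+ d * mmap k h p.
Proof.
move/dhomogP=> hp; rewrite /mmap mulr_sumr big_seq [RHS]big_seq.
apply: eq_bigr => m /hp <-; rewrite mulrCA; congr (_ * _).
rewrite /mmap1 /= mdegE; under eq_bigr do rewrite exprMn.
by rewrite big_split prodrXr.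
Qed.

(** * A functional that detects degree 7 *)

(** r is a square root of -1 in an extension R of F.  The element u, whose powers
    are distinct, makes degrees visible: rescaling all variables by u multiplies a
    form of degree d by u^d. *)
Section Functional.
Variables (x y : 'Q_8) (F : fieldType).
Hypothesis xy : quaternion_pair x y.
Variable rG : mx_representation F Q8xC2 9.
Hypothesis rGx : rG (x, 1%g) = signed_perm_mx F 8 perm_x.
Hypothesis rGy : rG (y, 1%g) = signed_perm_mx F 8 perm_y.
Hypothesis rGc : rG (1%g, Zp1) = signed_perm_mx F 8 perm_c.
Variables (R : idomainType) (iota : {rmorphism F -> R}) (r u : R).
Hypothesis r2 : r ^+ 2 = -1.
Hypothesis u_inj : forall a b, u ^+ a = u ^+ b -> a = b.
Hypothesis two_neq0 : (2%:R : F) != 0.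

(** The values of the nine coordinates when X, Y, X', Y', t take given values in a
    ring containing r, the image of i. *)
Definition point (T : comNzRingType) (i X Y X' Y' t : T) (k : nat) : T :=
  nth 0 [:: X; i * X; Y; i * Y; X'; i * X'; Y'; i * Y'; t] k.

Definition ev (T : comNzRingType) (j : {rmorphism R -> T}) (X Y X' Y' t : T)
    (p : {mpoly F[9]}) : T :=
  mmap (j \o iota) (fun k : 'I_9 => point (j r) X Y X' Y' t k) p.

Lemma ev_rmorph (S T : comNzRingType) (j : {rmorphism R -> S})
    (j' : {rmorphism R -> T}) (phi : {rmorphism S -> T}) X Y X' Y' t p :
  phi \o j =1 j' ->
  phi (ev j X Y X' Y' t p) = ev j' (phi X) (phi Y) (phi X') (phi Y') (phi t) p.
Proof.
move=> phij; rewrite /ev mmap_rmorph; apply: mmap_ext => [c|k] /=; first exact: phij.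
rewrite /point -phij /=; move: (nat_of_ord k) => m.
by do 9?[case: m => [|m] /=; rewrite ?rmorphM //]; rewrite !nth_nil rmorph0.
Qed.

Lemma ev_sym_act (T : comNzRingType) (j : {rmorphism R -> T}) g s
    X Y X' Y' t Xs Ys Xs' Ys' ts p : rG g = signed_perm_mx F 8 s -> signed_wf 8 s ->
  (forall k, (k < 9)%N ->
     (-1) ^+ (signed_entry s k).1 * point (j r) X Y X' Y' t (signed_entry s k).2 =
     point (j r) Xs Ys Xs' Ys' ts k) ->
  ev j X Y X' Y' t (sym_act rG g p) = ev j Xs Ys Xs' Ys' ts p.
Proof.
move=> rGg wf eq_pt; rewrite /ev mmap_sym_act; apply: mmap_ext => // k /=.
by rewrite -eq_pt // rGg (signed_perm_sum (j \o iota)).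
Qed.

Let jr2 (T : comNzRingType) (j : {rmorphism R -> T}) : j r * j r = -1.
Proof. by rewrite -rmorphM -expr2 r2 rmorphN rmorph1. Qed.

Lemma ev_act_x (T : comNzRingType) (j : {rmorphism R -> T}) X Y X' Y' t p :
  ev j X Y X' Y' t (sym_act rG (x, 1%g) p) =
  ev j (j r * X) (j (- r) * Y) (j r * X') (j (- r) * Y') t p.
Proof.
apply: ev_sym_act rGx _ _ => // -[|[|[|[|[|[|[|[|[|]]]]]]]]] //= _;
  by rewrite /point /= ?expr0 ?expr1 ?mul1r ?mulN1r ?rmorphN ?mulrA ?mulrN ?jr2
    ?opprK ?mulNr ?mul1r.
Qed.

Lemma ev_act_y (T : comNzRingType) (j : {rmorphism R -> T}) X Y X' Y' t p :
  ev j X Y X' Y' t (sym_act rG (y, 1%g) p) = ev j Y (- X) Y' (- X') t p.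
Proof.
apply: ev_sym_act rGy _ _ => // -[|[|[|[|[|[|[|[|[|]]]]]]]]] //= _;
  by rewrite /point /= ?expr0 ?expr1 ?mul1r ?mulrN ?mulN1r.
Qed.

Lemma ev_act_c (T : comNzRingType) (j : {rmorphism R -> T}) X Y X' Y' t p :
  ev j X Y X' Y' t (sym_act rG (1%g, Zp1) p) = ev j X Y (- X') (- Y') (- t) p.
Proof.
apply: ev_sym_act rGc _ _ => // -[|[|[|[|[|[|[|[|[|]]]]]]]]] //= _;
  by rewrite /point /= ?expr0 ?expr1 ?mul1r ?mulrN ?mulN1r.
Qed.

Lemma ev_homog (T : comNzRingType) (j : {rmorphism R -> T}) a X Y X' Y' t d p :
  p \is d.-homog ->
  ev j (a * X) (a * Y) (a * X') (a * Y') (a * t) p = a ^+ d * ev j X Y X' Y' t p.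
Proof.
move=> hp; rewrite /ev -(mmap_homog _ _ _ hp); apply: mmap_ext => // k.
rewrite /point; move: (nat_of_ord k) => m.
by do 9?[case: m => [|m] /=; rewrite ?[_ * (a * _)]mulrCA //]; rewrite nth_nil mulr0.
Qed.

(** Diagonal group elements act on the specialization Y' = 0 by rescaling its
    variables.  The ring T is kept abstract here, since computing in an explicit
    tower of polynomial rings is costly. *)
Section ScalingMorphism.
Variables (T : comNzRingType) (j : {rmorphism R -> T}) (X Y s t : T).

Definition scaling (phi : T -> T) (a b c e : R) :=
  [/\ phi \o j =1 j, phi X = j a * X, phi Y = j b * Y, phi s = j c * s
    & phi t = j e * t].

Variable phi : {rmorphism T -> T}.

Lemma scaling_ev a b c e p : scaling phi a b c e ->
  phi (ev j X Y s 0 t p) = ev j (j a * X) (j b * Y) (j c * s) 0 (j e * t) p.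
Proof.
by case=> phij eX eY es et; rewrite (ev_rmorph _ _ _ _ _ _ phij) eX eY es et rmorph0.
Qed.

Lemma scaling_act_x p : scaling phi r (- r) r 1 ->
  ev j X Y s 0 t (sym_act rG (x, 1%g) p) = phi (ev j X Y s 0 t p).
Proof. by move/scaling_ev->; rewrite ev_act_x mulr0 rmorph1 mul1r. Qed.

Lemma scaling_act_c p : scaling phi 1 1 (-1) (-1) ->
  ev j X Y s 0 t (sym_act rG (1%g, Zp1) p) = phi (ev j X Y s 0 t p).
Proof.
by move/scaling_ev->; rewrite ev_act_c oppr0 rmorphN rmorph1 !mul1r !mulN1r.
Qed.

Lemma scaling_homog a d p : scaling phi a a a a -> p \is d.-homog ->
  phi (ev j X Y s 0 t p) = j (a ^+ d) * ev j X Y s 0 t p.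
Proof.
move/scaling_ev-> => hp; rewrite -[X in ev _ _ _ _ X](mulr0 (j a)).
by rewrite (ev_homog _ _ _ _ _ _ _ hp) rmorphXn.
Qed.

End ScalingMorphism.

Local Notation T2 := {poly {poly R}}.
Local Notation T4 := {poly {poly T2}}.

(** In T4 the variables X, Y, s = X', t are adjoined in this order, so the
    outermost coefficient is that of a power of t; T2 keeps X and Y only. *)
Definition const2 : {rmorphism R -> T2} := polyC \o polyC.
Definition const4 : {rmorphism R -> T4} := polyC \o (polyC \o (polyC \o polyC)).

Definition var_x : T4 := 'X%:P%:P%:P.
Definition var_y : T4 := 'X%:P%:P.
Definition var_s : T4 := 'X%:P.
Definition var_t : T4 := 'X.

Definition coef4 (P : T4) (i j k l : nat) : R := P`_l`_k`_j`_i.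

Definition scale4 (a b c e : R) : {rmorphism T4 -> T4} :=
  scale_var (e%:P%:P%:P) \o map_poly (scale_var (c%:P%:P)
    \o map_poly (scale_var b%:P \o map_poly (scale_var a))).

Lemma coef_scale4 a b c e P i j k l :
  coef4 (scale4 a b c e P) i j k l = a ^+ i * b ^+ j * c ^+ k * e ^+ l * coef4 P i j k l.
Proof.
rewrite /coef4 /scale4 /=.
rewrite coef_scale_var coef_map /= -!rmorphXn !coefCM.
rewrite coef_scale_var coef_map /= -!rmorphXn !coefCM.
rewrite coef_scale_var coef_map /= -!rmorphXn !coefCM.
rewrite coef_scale_var.
by ring.
Qed.

Lemma scale4_const a b c e : scale4 a b c e \o const4 =1 const4.
Proof.
by move=> q; rewrite /scale4 /= map_polyC /= map_polyC /= map_polyC /= !scale_varC.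
Qed.

Lemma scale4_x a b c e : scale4 a b c e var_x = const4 a * var_x.
Proof.
rewrite /scale4 /= /var_x map_polyC /= map_polyC /= map_polyC /= !scale_varC scale_varX.
by rewrite -mul_polyC !rmorphM.
Qed.
Lemma scale4_y a b c e : scale4 a b c e var_y = const4 b * var_y.
Proof.
rewrite /scale4 /= /var_y map_polyC /= map_polyC /= map_polyX /= !scale_varC scale_varX.
by rewrite -mul_polyC !rmorphM.
Qed.
Lemma scale4_s a b c e : scale4 a b c e var_s = const4 c * var_s.
Proof.
rewrite /scale4 /= /var_s map_polyC /= map_polyX /= !scale_varC scale_varX.
by rewrite -mul_polyC !rmorphM.
Qed.
Lemma scale4_t a b c e : scale4 a b c e var_t = const4 e * var_t.
Proof. by rewrite /scale4 /= /var_t map_polyX /= scale_varX -mul_polyC. Qed.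

Definition ev4 (p : {mpoly F[9]}) : T4 := ev const4 var_x var_y var_s 0 var_t p.

Lemma scale4_scaling a b c e :
  scaling const4 var_x var_y var_s var_t (scale4 a b c e) a b c e.
Proof.
exact: And5 (scale4_const a b c e) (scale4_x a b c e) (scale4_y a b c e)
  (scale4_s a b c e) (scale4_t a b c e).
Qed.

Lemma coef_act_x p i j k l :
  coef4 (ev4 (sym_act rG (x, 1%g) p)) i j k l = r ^+ (i + 3 * j + k) * coef4 (ev4 p) i j k l.
Proof.
have rj : r ^+ (3 * j)%N = (- r) ^+ j by rewrite exprM exprS r2 mulrN1.
rewrite (exprD _ (i + 3 * j)) (exprD _ i) rj -[_ * _ * r ^+ k]mulr1 -(expr1n _ l).
rewrite -coef_scale4; apply: (congr1 (fun P => coef4 P i j k l)).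
exact: scaling_act_x (scale4_scaling _ _ _ _).
Qed.

Lemma coef_act_c p i j k l :
  coef4 (ev4 (sym_act rG (1%g, Zp1) p)) i j k l = (-1) ^+ (k + l) * coef4 (ev4 p) i j k l.
Proof.
have -> : (-1) ^+ (k + l) = 1 ^+ i * 1 ^+ j * (-1) ^+ k * (-1) ^+ l :> R.
  by rewrite !expr1n !mul1r exprD.
rewrite -coef_scale4; apply: (congr1 (fun P => coef4 P i j k l)).
exact: scaling_act_c (scale4_scaling _ _ _ _).
Qed.

Lemma coef4_const a P i j k l : coef4 (const4 a * P) i j k l = a * coef4 P i j k l.
Proof. by rewrite /coef4 /const4 /= !coefCM. Qed.

(** Rescaling every variable by u multiplies the coefficient by u^(i + j + k + l)
    on one hand and by u^d on the other. *)
Lemma coef_homog p d i j k l : p \is d.-homog -> (i + j + k + l != d)%N ->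
  coef4 (ev4 p) i j k l = 0.
Proof.
move=> hp nd.
have := congr1 (fun P => coef4 P i j k l) (scaling_homog (scale4_scaling u u u u) hp).
rewrite coef_scale4 coef4_const -!exprD => /eqP.
rewrite -subr_eq0 -mulrBl mulf_eq0 subr_eq0 => /orP[/eqP/u_inj e|/eqP//].
by rewrite e eqxx in nd.
Qed.

(** The exponents of the monomials X^i Y^j X'^k t^l fixed by the first generator of
    Q_8, acting by r^(i + 3 j + k) as -r = r^3, and by C_2. *)
Definition invariant_exponent i j k l := ((i + 3 * j + k) %% 4 == 0)%N && ~~ odd (k + l).

Let two_neq0R : (2%:R : R) != 0.
Proof. by rewrite -(rmorph_nat iota) fmorph_eq0. Qed.

Lemma root_power_neq1 m : (m %% 4 != 0)%N -> r ^+ m != 1.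
Proof.
have N1 : (-1 : R) != 1.
  by rewrite eq_sym -subr_eq0 opprK -(natrD _ 1 1).
have r4 : r ^+ 4 = 1 by rewrite (exprM r 2 2) r2 sqrrN expr1n.
have r1 : r != 1 by apply: contra N1 => /eqP e; rewrite -r2 e expr1n.
move=> m4; rewrite (divn_eq m 4) exprD mulnC exprM r4 expr1n mul1r.
case: (m %% 4)%N m4 (ltn_pmod m (isT : (0 < 4)%N)) => [|[|[|[|m']]]] // _ _.
  by rewrite r2.
rewrite exprS r2 mulrN1; apply: contra r1 => /eqP e.
have : r ^+ 2 = 1 by rewrite -sqrrN e expr1n.
by rewrite r2 => /eqP; rewrite (negPf N1).
Qed.

Lemma coef_invariant p i j k l : sym_invariant rG p ->
  ~~ invariant_exponent i j k l -> coef4 (ev4 p) i j k l = 0.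
Proof.
move=> inv; rewrite negb_and => /orP[/root_power_neq1 nr | odd_kl].
  have := coef_act_x p i j k l; rewrite inv ?Q8xC2_full // => /eqP.
  by rewrite -[X in X == _]mul1r -subr_eq0 -mulrBl mulf_eq0 subr_eq0 eq_sym (negPf nr) => /eqP.
have := coef_act_c p i j k l; rewrite inv ?Q8xC2_full // => /eqP.
rewrite -signr_odd (negbNE odd_kl) expr1 mulN1r -subr_eq0 opprK -mulr2n -mulr_natl.
by rewrite mulf_eq0 (negPf two_neq0R) => /eqP.
Qed.

(** The second generator of Q_8 moves X' to Y', so it is visible only after setting
    X' = Y' = t = 0 as well. *)
Definition ev2 (p : {mpoly F[9]}) : T2 := ev const2 'X%:P 'X 0 0 0 p.

Lemma ev2_coef p i j : coef4 (ev4 p) i j 0 0 = (ev2 p)`_j`_i.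
Proof.
(* Setting t = 0 and X' = 0 extracts the constant coefficients in these variables. *)
pose phi : {rmorphism T4 -> T2} := coefp 0 \o coefp 0.
suff : phi (ev4 p) = ev2 p by rewrite /coef4 => <-.
have pj : phi \o const4 =1 const2 by move=> c; rewrite /phi /= !coefC.
rewrite /ev4 (ev_rmorph _ _ _ _ _ _ pj) /ev2; congr (ev _ _ _ _ _ _ _).
- by rewrite /phi /= /var_x !coefC.
- by rewrite /phi /= /var_y !coefC.
- by rewrite /phi /= /var_s coefC coefX.
- exact: rmorph0.
- by rewrite /phi /= /var_t coefX coef0.
Qed.

Definition rotate : {rmorphism T2 -> T2} := map_poly (scale_var (-1)) \o @swapXY R.

Lemma ev2_act_y p : ev2 (sym_act rG (y, 1%g) p) = rotate (ev2 p).
Proof.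
have pj : rotate \o const2 =1 const2.
  move=> c; rewrite /rotate /const2 /= swapXY_polyC map_polyC /= map_polyC /=.
  by rewrite scale_varC.
rewrite /ev2 ev_act_y oppr0 (ev_rmorph _ _ _ _ _ _ pj) rmorph0.
congr (ev _ _ _ _ _ _ _); rewrite /rotate /=.
  by rewrite swapXY_Y map_polyX.
by rewrite swapXY_X map_polyC /= scale_varX scaleN1r rmorphN.
Qed.

Lemma coef_swap p i j : sym_invariant rG p ->
  coef4 (ev4 p) i j 0 0 = (-1) ^+ i * coef4 (ev4 p) j i 0 0.
Proof.
move=> inv; rewrite !ev2_coef -{1}(inv _ (Q8xC2_full (y, 1%g))) ev2_act_y.
by rewrite /rotate /= coef_map /= coef_scale_var coef_swapXY.
Qed.

Lemma coef_x4_y4 p : sym_invariant rG p ->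
  coef4 (ev4 p) 4 0 0 0 = coef4 (ev4 p) 0 4 0 0.
Proof. by move=> inv; rewrite coef_swap // -signr_odd mul1r. Qed.

Lemma coef_xy p : sym_invariant rG p -> coef4 (ev4 p) 1 1 0 0 = 0.
Proof.
move=> inv; have /eqP := coef_swap 1 1 inv.
rewrite expr1 mulN1r -subr_eq0 opprK -mulr2n -mulr_natl.
by rewrite mulf_eq0 (negPf two_neq0R) => /eqP.
Qed.

Lemma coef4M (P Q : T4) i j k l : coef4 (P * Q) i j k l =
  \sum_(l1 < l.+1) \sum_(k1 < k.+1) \sum_(j1 < j.+1) \sum_(i1 < i.+1)
    coef4 P i1 j1 k1 l1 * coef4 Q (i - i1) (j - j1) (k - k1) (l - l1).
Proof.
rewrite /coef4 coefM !coef_sum; apply: eq_bigr => l1 _.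
rewrite coefM !coef_sum; apply: eq_bigr => k1 _.
by rewrite coefM !coef_sum; apply: eq_bigr => j1 _; rewrite coefM.
Qed.

Definition convolution (f g : nat -> nat -> nat -> nat -> R) i j k l :=
  \sum_(l1 < l.+1) \sum_(k1 < k.+1) \sum_(j1 < j.+1) \sum_(i1 < i.+1)
    f i1 j1 k1 l1 * g (i - i1)%N (j - j1)%N (k - k1)%N (l - l1)%N.

Lemma convolution_supp f g i j k l :
  (forall i j k l, ~~ invariant_exponent i j k l -> f i j k l = 0) ->
  convolution f g i j k l =
  \sum_(l1 < l.+1) \sum_(k1 < k.+1) \sum_(j1 < j.+1) \sum_(i1 < i.+1)
    if invariant_exponent i1 j1 k1 l1 then
    f i1 j1 k1 l1 * g (i - i1)%N (j - j1)%N (k - k1)%N (l - l1)%N else 0.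
Proof.
move=> fz; do 4![apply: eq_bigr => ? _].
by case: ifPn => // /fz->; rewrite mul0r.
Qed.

(** Of the factorizations of X^4 Y X' t and Y^5 X' t those by exponents of invariant
    monomials are: the trivial ones, X^4 * Y X' t, X Y * X^3 X' t and
    Y^4 * Y X' t.  The terms at X Y vanish, and those at X^4 cancel against those
    at Y^4. *)
Lemma convolution_difference f g :
  (forall i j k l, ~~ invariant_exponent i j k l -> f i j k l = 0) ->
  f 1 1 0 0 = 0 -> g 1 1 0 0 = 0 ->
  f 4 0 0 0 = f 0 4 0 0 -> g 4 0 0 0 = g 0 4 0 0 ->
  convolution f g 4 1 1 1 - convolution f g 0 5 1 1 =
  f 0 0 0 0 * (g 4 1 1 1 - g 0 5 1 1) + (f 4 1 1 1 - f 0 5 1 1) * g 0 0 0 0.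
Proof.
move=> fz f11 g11 f4 g4; rewrite !(convolution_supp _ _ _ _ _ fz).
rewrite !big_ord_recl !big_ord0 /= /invariant_exponent /=.
rewrite /bump !leq0n /= !add1n !(subSS, subn0) !(add0r, addr0) f11 g11 f4 g4.
by ring.
Qed.

Definition functional (p : {mpoly F[9]}) : R :=
  coef4 (ev4 p) 4 1 1 1 - coef4 (ev4 p) 0 5 1 1.

(** The functional is a derivation at the augmentation of the ring of invariants,
    hence it vanishes on decomposable invariants. *)
Lemma functionalM p q : sym_invariant rG p -> sym_invariant rG q ->
  functional (p * q) = coef4 (ev4 p) 0 0 0 0 * functional q
    + functional p * coef4 (ev4 q) 0 0 0 0.
Proof.
move=> ip iq; have evM : ev4 (p * q) = ev4 p * ev4 q by apply: rmorphM.
have cM i j k l : coef4 (ev4 (p * q)) i j k l =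
    convolution (coef4 (ev4 p)) (coef4 (ev4 q)) i j k l.
  by rewrite evM; apply: coef4M.
apply: etrans (congr2 (fun a b => a - b) (cM 4 1 1 1) (cM 0 5 1 1)) _.
exact: (convolution_difference (fun i j k l => @coef_invariant p i j k l ip)
  (coef_xy ip) (coef_xy iq) (coef_x4_y4 ip) (coef_x4_y4 iq)).
Qed.

Lemma functionalP c p q :
  functional (c *: p + q) = iota c * functional p + functional q.
Proof.
have evP : ev4 (c *: p + q) = const4 (iota c) * ev4 p + ev4 q.
  by apply: etrans (mmapD _ _ _ _) _; congr (_ + _); apply: mmapZ.
have cP i j k l : coef4 (ev4 (c *: p + q)) i j k l =
    iota c * coef4 (ev4 p) i j k l + coef4 (ev4 q) i j k l.
  rewrite evP -coef4_const; move: (const4 _ * _) (ev4 q) => P Q.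
  by rewrite /coef4 !coefD.
have lin (e a b a' b' : R) : e * a + b - (e * a' + b') = e * (a - a') + (b - b').
  by ring.
exact: etrans (congr2 (fun a b => a - b) (cP 4 1 1 1) (cP 0 5 1 1)) (lin _ _ _ _ _).
Qed.

Lemma functional_homog d p : p \is d.-homog -> (d < 7)%N -> functional p = 0.
Proof.
by move=> hp d7; rewrite /functional !(coef_homog hp) ?subrr // gtn_eqF.
Qed.

Lemma functional_generated d p : (d < 7)%N ->
  generated_subalgebra (homog_invariant_le rG d) p ->
  sym_invariant rG p /\ functional p = 0.
Proof.
move=> d7; elim=> [a [inv_a [k kd ha]] | |c a b _ [ia fa] _ [ib fb]|a b _ [ia fa] _ [ib fb]].
- by split=> //; apply: functional_homog ha _; apply: leq_ltn_trans d7.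
- split; last by apply: (@functional_homog 0) => //; apply: dhomog1.
  by move=> g _; apply: rmorph1.
- split; last by rewrite functionalP fa fb mulr0 addr0.
  by move=> g gG; rewrite linearP /= ia // ib.
- split; last by rewrite functionalM // fa fb mulr0 mul0r addr0.
  by move=> g gG; rewrite rmorphM /= ia // ib.
Qed.

(** The coordinates of indices 0, 2, 4, 8 are X, Y, X' and t. *)
Definition witness : {mpoly F[9]} :=
  'X_(inord 0) ^+ 4 * 'X_(inord 2) * 'X_(inord 4) * 'X_(inord 8).

Lemma ev_witness (T : comNzRingType) (j : {rmorphism R -> T}) X Y X' Y' t :
  ev j X Y X' Y' t witness = X ^+ 4 * Y * X' * t.
Proof.
pose k : {rmorphism F -> T} := j \o iota.
pose h (i : 'I_9) := point (j r) X Y X' Y' t i.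
rewrite -[LHS]/(mmap k h witness) /witness 3!rmorphM rmorphXn /= !mmapX !mmap1U.
by rewrite /h /point !inordK.
Qed.

Lemma functional_witness : functional witness = 1.
Proof.
have e : ev4 witness = ((('X^4)%:P * 'X)%:P * 'X)%:P * 'X.
  apply: etrans (ev_witness _ _ _ _ _ _) _.
  by rewrite /var_x /var_y /var_s /var_t 3!polyCM 3!polyC_exp.
have c i j : coef4 (ev4 witness) i j 1 1 = ((i == 4) && (j == 1))%:R.
  rewrite e /coef4 coefMX /= coefC /= coefMX /= coefC /= coefMX.
  case: j => [|[|j]] /=; rewrite ?coefC /= ?coef0 ?coefXn ?if_same; by case: (i == 4)%N.
by apply: etrans (congr2 (fun a b => a - b) (c 4 1) (c 0 5)) _; rewrite subr0.
Qed.

Lemma functional_ev4_eq0 p : ev4 p = 0 -> functional p = 0.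
Proof.
move=> e; have c i j k l : coef4 (ev4 p) i j k l = 0 by rewrite e /coef4 !coef0.
by apply: etrans (congr2 (fun a b => a - b) (c 4 1 1 1) (c 0 5 1 1)) (subrr _).
Qed.

Local Notation X := (sym_act rG (x, 1%g)).
Local Notation Y := (sym_act rG (y, 1%g)).
Local Notation C := (sym_act rG (1%g, Zp1)).

Lemma functional_act_x p : functional (X p) = functional p.
Proof.
have r4 : r ^+ 4 = 1 by rewrite (exprM r 2 2) r2 sqrrN expr1n.
have c i j : r ^+ (i + 3 * j + 1) = 1 -> coef4 (ev4 (X p)) i j 1 1 = coef4 (ev4 p) i j 1 1.
  by move=> e; rewrite coef_act_x e mul1r.
apply: (congr2 (fun a b => a - b) (c 4 1 _) (c 0 5 _)).
  by rewrite (exprM r 4 2) r4 expr1n.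
by rewrite (exprM r 4 4) r4 expr1n.
Qed.

Lemma functional_act_c p : functional (C p) = functional p.
Proof.
have c i j : coef4 (ev4 (C p)) i j 1 1 = coef4 (ev4 p) i j 1 1.
  by rewrite coef_act_c -signr_odd mul1r.
exact: (congr2 (fun a b => a - b) (c 4 1) (c 0 5)).
Qed.

Lemma functional_average (T : {mpoly F[9]} -> {mpoly F[9]}) p :
  functional (average T p) = iota 2%:R^-1 * (functional p + functional (T p)).
Proof.
rewrite /average -[_ *: _]addr0 functionalP -[p in functional (p + _)]scale1r.
have f0 : functional 0 = 0 by apply: functional_ev4_eq0; apply: mmap0.
by rewrite functionalP f0 addr0 rmorph1 mul1r.
Qed.

Lemma functional_average_id (T : {mpoly F[9]} -> {mpoly F[9]}) p :
  functional (T p) = functional p -> functional (average T p) = functional p.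
Proof.
have half : iota 2%:R^-1 * 2%:R = 1.
  by rewrite -(rmorph_nat iota) -rmorphM mulVf // rmorph1.
by move=> e; rewrite functional_average e -mulr2n -[functional p *+ 2]mulr_natl mulrA half mul1r.
Qed.

(** The second generator replaces the factor X' by Y', which is specialized to 0;
    the first generator only rescales that factor. *)
Lemma functional_act_y_witness k : functional (Y (iter k X witness)) = 0.
Proof.
apply: functional_ev4_eq0; apply: etrans (ev_act_y _ _ _ _ _ _ _) _.
elim: k var_y (- var_x) (- var_s) => [|k IH] X1 Y1 Y1'.
  by rewrite /= ev_witness mulr0 mul0r.
by rewrite /= ev_act_x mulr0 IH.
Qed.

(** Averaging over the first generator of Q_8 and over C_2 preserves the
    functional, and averaging over the second generator halves it. *)
Lemma functional_reynolds_witness : functional (reynolds X Y C witness) != 0.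
Proof.
rewrite /reynolds functional_average_id; last exact: functional_act_c.
rewrite functional_average_id; last exact: functional_act_x.
rewrite functional_average functional_average_id; last by rewrite /= !functional_act_x.
have -> : functional (Y (average (X \o X) witness)) = 0.
  rewrite /average linearZ linearD /= -[_ *: _]addr0 functionalP.
  rewrite -[Y witness]scale1r functionalP.
  rewrite (functional_act_y_witness 0) (functional_act_y_witness 2).
  by rewrite functional_ev4_eq0 ?mulr0 ?addr0 ?mulr0 //; apply: mmap0.
by rewrite functional_witness addr0 mulr1 fmorph_eq0 invr_neq0.
Qed.

Lemma not_generated_lt7 d : (d < 7)%N -> ~ invariants_generated_upto rG d.
Proof.
move=> d7 gen; have := functional_reynolds_witness.
suff inv : sym_invariant rG (reynolds X Y C witness).
  by have [_ ->] := functional_generated d7 (gen _ inv); rewrite eqxx.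
apply/(sym_invariantP xy); apply: fixed_by_generators_reynolds => f.
- exact: (act_x4 xy).
- exact: (act_y2 xy).
- exact: (act_xy xy).
- exact: act_c2.
- exact: act_cx.
- exact: act_cy.
Qed.

End Functional.

(** * The Noether number *)

Theorem proposition3p2 (F : fieldType) (hchar : 2%N \notin [pchar F]%R) :
  is_noether_number F Q8xC2 7.
Proof.
have two_neq0 : (2%:R : F) != 0 by move: hchar; rewrite inE.
have [x [y xy]] := quaternion_generators.
split=> [n rG|c bounded_c].
  exact/is_beta_ex/(invariants_generated_le7 xy).
have [rG [rGx rGy rGc]] := witness_module F xy.
have [d [gen_d _] le_dc] := bounded_c 9 rG.
apply: leq_trans le_dc; rewrite leqNgt; apply/negP=> d7.
(* In the polynomial ring over K the powers of the variable are distinct, also when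
   K is finite, so the variable can serve as u. *)
have [K [iota [r r2]]] := sqrtN1_extension F.
have r2P : (r%:P : {poly K}) ^+ 2 = -1 by rewrite -rmorphXn r2 rmorphN rmorph1.
have X_inj a b : ('X : {poly K}) ^+ a = 'X ^+ b -> a = b.
  by move/(congr1 (fun p : {poly K} => size p)); rewrite !size_polyXn => -[].
exact: (@not_generated_lt7 x y F xy rG rGx rGy rGc {poly K} (polyC \o iota) r%:P 'X
  r2P X_inj two_neq0 d d7 gen_d).
Qed.
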